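(* Let $s\ge 2$, $1\le d\le s$ and $1\le r\le\dim_K KV_{\le d}$ be integers with $d+r-2<s$. Then $$d_r(C_{\le d})=(q-2)^{d-1}(q-1)^{s-d-r+1}\left[(q-1)^r-1\right].$$
   Context: $K=\mathbb{F}_q$ is the finite field with $q$ elements, $q$ a power of a prime, and $S=K[t_1,\dots,t_s]$. $KV_{\le d}$ is the $K$-span of all square-free monomials of $S$ of degree at most $d$, i.e. monomials $t_1^{a_1}\cdots t_s^{a_s}$ with all $a_i\in\{0,1\}$ and $\sum a_i\le d$. $T=(\mathbb{F}_q^* )^s=\{P_1,\dots,P_m\}$, $m=(q-1)^s$, is the affine torus. The square-free affine evaluation code $C_{\le d}$ of degree $d$ is the image of $KV_{\le d}\to\mathbb{F}_q^m$, $f\mapsto(f(P_1),\dots,f(P_m))$. $V_T(H)$ denotes the set of common zeros in $T$ of the polynomials in $H$. For $1\le r\le\dim_K KV_{\le d}$, the $r$-th generalized Hamming weight of $C_{\le d}$ is $$d_r(C_{\le d}):=\min\{|T\setminus V_T(H)| : H=\{f_1,\dots,f_r\}\subseteq KV_{\le d} \text{ linearly independent over } K\}.$$ (For $q\ge3$ this is the usual $r$-th generalized Hamming weight, i.e. the minimum support size of an $r$-dimensional subcode.) *)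

(* Defs.v *)
From HB Require Import structures.
From mathcomp Require Import all_boot all_order all_algebra all_field.
From mathcomp Require Import mpoly.

Set Implicit Arguments.
Unset Strict Implicit.
Unset Printing Implicit Defensive.

Import GRing.Theory.
Local Open Scope ring_scope.

Definition sqfree_mnm (s : nat) (m : 'X_{1..s}) : bool :=
  [forall i : 'I_s, (m i <= 1)%N].

Definition is_KVle (F : fieldType) (s d : nat) (f : {mpoly F[s]}) : bool :=
  all (fun m => sqfree_mnm m && (mdeg m <= d)%N) (msupp f).

(* [is_KVle] is membership in the span of the square-free monomials of degree
   at most [d]. *)
Lemma is_KVleP (F : fieldType) (s d : nat) (f : {mpoly F[s]}) :
  reflect
    (exists c : 'X_{1..s < d.+1} -> F,
       f = \sum_(m : 'X_{1..s < d.+1} | sqfree_mnm m) c m *: 'X_[m])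
    (is_KVle d f).
Proof.
apply: (iffP allP) => [fKV | [c ->] m].
- exists (fun m => f@_m).
  apply/mpolyP => k; rewrite raddf_sum /=.
  under eq_bigr => m _ do rewrite mcoeffZ mcoeffX.
  have [ksupp | knsupp] := boolP (k \in msupp f).
    have /andP[ksq kdeg] := fKV k ksupp.
    have kdeg' : (mdeg k < d.+1)%N by [].
    rewrite (bigD1 (BMultinom kdeg')) //= eqxx mulr1 big1 ?addr0 // => m.
    by case/andP=> _; rewrite -val_eqE /= => /negPf->; rewrite mulr0.
  rewrite (memN_msupp_eq0 knsupp) big1 // => m _.
  by case: eqP => [->|_]; rewrite ?(memN_msupp_eq0 knsupp) ?mul0r ?mulr0.
- rewrite mcoeff_msupp raddf_sum /= => nz.
  have [// | bad] := boolP (sqfree_mnm m && (mdeg m <= d)%N).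
  case/eqP: nz; apply: big1 => k ksq; rewrite mcoeffZ mcoeffX.
  case: eqP => [km | _]; last by rewrite mulr0.
  by move: bad; rewrite -km ksq -ltnS bmdeg.
Qed.

Lemma is_KVle_submod (F : fieldType) (s d : nat) :
  submod_closed (@is_KVle F s d).
Proof.
split=> [|a f g /allP fKV /allP gKV]; first by rewrite unfold_in msupp0.
apply/allP => m /msuppD_le; rewrite mem_cat => /orP[/msuppZ_le|]; first exact: fKV.
exact: gKV.
Qed.

HB.instance Definition _ (F : fieldType) (s d : nat) :=
  GRing.isSubmodClosed.Build F {mpoly F[s]} (@is_KVle F s d)
    (is_KVle_submod F s d).

Record KVle (F : fieldType) (s d : nat) :=
  MkKVle { KVle_val :> {mpoly F[s]}; _ : @is_KVle F s d KVle_val }.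

HB.instance Definition _ (F : fieldType) (s d : nat) :=
  [isSub for @KVle_val F s d].
HB.instance Definition _ (F : fieldType) (s d : nat) :=
  [Choice of KVle F s d by <:].
HB.instance Definition _ (F : fieldType) (s d : nat) :=
  [SubChoice_isSubLmodule of KVle F s d by <:].

Definition sqfree_mnms (s d : nat) : {set 'X_{1..s < d.+1}} :=
  [set m : 'X_{1..s < d.+1} | sqfree_mnm m].

Lemma KVle_vecaxiom (F : fieldType) (s d : nat) :
  Vector.axiom #|sqfree_mnms s d| (KVle F s d).
Proof.
pose N := #|sqfree_mnms s d|.
pose mon (i : 'I_N) : 'X_{1..s < d.+1} := enum_val i.
pose co (f : KVle F s d) : 'rV[F]_N := \row_i (val f)@_(mon i).
pose po (v : 'rV[F]_N) : {mpoly F[s]} := \sum_i v 0 i *: 'X_[mon i].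
have poKV v : is_KVle d (po v).
  change (po v \in @is_KVle F s d); apply: rpred_sum => i _.
  apply: rpredZ; rewrite unfold_in /is_KVle msuppX /= andbT -ltnS bmdeg andbT.
  by have := enum_valP i; rewrite inE.
exists co => [a f g|]; first by apply/rowP => i; rewrite !mxE mcoeffD mcoeffZ.
exists (fun v => MkKVle (poKV v)) => [f|v].
- apply/val_inj/mpolyP => k /=; rewrite raddf_sum /=.
  under eq_bigr => i _ do rewrite mcoeffZ mcoeffX mxE.
  have [ksupp | knsupp] := boolP (k \in msupp (val f)).
    have /andP[ksq kdeg] := allP (valP f) k ksupp.
    have kdeg' : (mdeg k < d.+1)%N by [].
    have kin : BMultinom kdeg' \in sqfree_mnms s d by rewrite inE.
    rewrite (bigD1 (enum_rank_in kin (BMultinom kdeg'))) //= /mon enum_rankK_in //=.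
    rewrite eqxx mulr1 big1 ?addr0 // => i ne.
    case: eqP => [ek | _]; last by rewrite mulr0.
    case/eqP: ne; apply: enum_val_inj; rewrite enum_rankK_in //.
    exact/val_inj/esym.
  rewrite (memN_msupp_eq0 knsupp) big1 // => i _.
  by case: eqP => [->|_]; rewrite ?(memN_msupp_eq0 knsupp) ?mul0r ?mulr0.
- apply/rowP => j; rewrite mxE /= raddf_sum /= (bigD1 j) //=.
  rewrite mcoeffZ mcoeffX eqxx mulr1 big1 ?addr0 // => i ne.
  rewrite mcoeffZ mcoeffX; case: eqP => [ek | _]; last by rewrite mulr0.
  by case/eqP: ne; apply/enum_val_inj/val_inj.
Qed.

HB.instance Definition _ (F : fieldType) (s d : nat) :=
  Lmodule_hasFinDim.Build F (KVle F s d) (KVle_vecaxiom F s d).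

Definition torus (F : finFieldType) (s : nat) : {set {ffun 'I_s -> F}} :=
  [set P : {ffun 'I_s -> F} | [forall i, P i != 0]].

Definition torus_zeros (F : finFieldType) (s : nat) (H : seq {mpoly F[s]}) :
  {set {ffun 'I_s -> F}} :=
  [set P in torus F s | all (fun f => f.@[P] == 0) H].

(* The default value [#|torus F s|] bounds every term of the minimum, so it is
   irrelevant as soon as a linearly independent family of size [r] exists;
   see [ghwP].  The minimum ranges over independent families of polynomials,
   not of codewords: the two differ when [#|F| = 2], where evaluation is not
   injective. *)
Definition ghw (F : finFieldType) (s d r : nat) : nat :=
  \big[minn/#|torus F s|]_(H : r.-tuple (finvect_type (KVle F s d)) | free H)
     #|torus F s :\: torus_zeros [seq KVle_val f | f <- H]|.

Lemma ghwP (F : finFieldType) (s d r : nat) :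
  (r <= \dim {: KVle F s d})%N ->
  (exists2 H : r.-tuple (KVle F s d), free H &
     ghw F s d r = #|torus F s :\: torus_zeros [seq KVle_val f | f <- H]|) /\
  (forall H : r.-tuple (KVle F s d), free H ->
     (ghw F s d r <= #|torus F s :\: torus_zeros [seq KVle_val f | f <- H]|)%N).
Proof.
move=> ler.
pose w (H : r.-tuple (finvect_type (KVle F s d))) : nat :=
  #|torus F s :\: torus_zeros [seq KVle_val f | f <- H]|.
pose fT := r.-tuple (finvect_type (KVle F s d)).
have le_w (H : fT) : free H -> (ghw F s d r <= w H)%N.
  rewrite /ghw => frH; have : H \in index_enum fT by rewrite mem_index_enum.
  elim: (index_enum fT) => //= G l IH; rewrite inE big_cons.
  case/predU1P=> [<-|/IH le_l]; first by rewrite frH geq_minl.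
  by case: ifP => // _; rewrite geq_min le_l orbT.
split; last exact: le_w.
have [H0 frH0] : exists H : r.-tuple (KVle F s d), free H.
  have sz : size (take r (vbasis {: KVle F s d})) == r.
    by rewrite size_takel // size_tuple.
  exists (Tuple sz) => /=.
  have := basis_free (vbasisP {: KVle F s d}).
  by rewrite -{1}(cat_take_drop r (vbasis _)); apply: catl_free.
have le_T (H : fT) : (w H <= #|torus F s|)%N by rewrite subset_leq_card ?subsetDl.
have [H frH minH] :=
  arg_minnP (P := fun H : fT => free H) w frH0.
exists H => //; apply/eqP; rewrite eqn_leq le_w //=.
by rewrite /ghw; elim/big_ind: _ => // [|x y lx ly]; [exact: le_T | rewrite leq_min lx].
Qed.

(* Main.v *)
(* Lower bound.  Let [V] be an [r]-dimensional space of square-free polynomials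
   of degree at most [d], and [N V] the number of torus points at which some
   element of [V] is nonzero.  Each [f] is affine in the variable [t_i], with
   slope [f^`M(i)], so counting along the lines parallel to the [i]-th axis gives
     (q - 1) N V >= (q - 2) N (d_i V) + N (V :&: ker d_i),
   where [d_i V] has degree at most [d - 1] and the two dimensions add up to [r].
   With [y = 1 / (q - 1)] and [p = 1 - y], induction on the number of variables
   occurring in [V] yields [p N V >= p ^ d (1 - y ^ r) (q - 1) ^ s]; the
   inductive step is the inequality [(y - y ^ a) (1 - y ^ b) >= 0] for [a >= 1].
   The factor [p] is kept on the left so that the case [d = 0], where [V]
   consists of constants, needs no negative power.

   Equality holds for the polynomials
     (t_1 - 1) ... (t_(d-1) - 1) (t_(d-1+i) - 1),  1 <= i <= r.

   For [q = 2] both sides vanish. *)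

From HB Require Import structures.
Require Import Defs.
From mathcomp Require Import all_boot all_order all_algebra all_field.
From mathcomp Require Import mpoly ring zify.

Import Order.TTheory GRing.Theory Num.Theory.

(** * Derivatives and coordinate scaling of square-free polynomials *)

Section SquareFree.
Local Open Scope ring_scope.
Context {F : fieldType} {s : nat}.
Implicit Types (d : nat) (i : 'I_s).

Lemma KVle_valD d : {morph @KVle_val F s d : f g / f + g}.
Proof. exact: (raddfD \val). Qed.

Lemma KVle_valZ d a : {morph @KVle_val F s d : f / a *: f}.
Proof. exact: GRing.valZ. Qed.

Lemma KVle_val_sum d I (r : seq I) (P : pred I) (f : I -> KVle F s d) :
  KVle_val (\sum_(i <- r | P i) f i) = \sum_(i <- r | P i) KVle_val (f i).
Proof. exact: (raddf_sum \val). Qed.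

Lemma mderiv_is_KVle d i (f : {mpoly F[s]}) :
  is_KVle d f -> is_KVle d.-1 f^`M(i).
Proof.
move=> /allP fKV; apply/allP => m; rewrite mcoeff_msupp mcoeff_deriv => nz.
have /fKV : (m + U_(i))%MM \in msupp f.
  by rewrite mcoeff_msupp; apply: contraNneq nz => ->; rewrite mul0rn.
case/andP=> /forallP sq; rewrite mdegD mdeg1 addn1 => le_d.
apply/andP; split; last by lia.
by apply/forallP => j; apply: leq_trans (sq j); rewrite mnmDE leq_addr.
Qed.

Definition KVle_deriv d i (f : KVle F s d) : KVle F s d.-1 :=
  MkKVle (mderiv_is_KVle d i f (valP f)).

Lemma KVle_deriv_is_linear d i : linear (KVle_deriv d i).
Proof.
move=> a f g; apply: val_inj.
rewrite [RHS](KVle_valD _ (a *: KVle_deriv d i f) (KVle_deriv d i g)) KVle_valZ.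
by rewrite -mderivZ -mderivD -KVle_valZ -KVle_valD.
Qed.

HB.instance Definition _ d i :=
  GRing.isLinear.Build F (KVle F s d) (KVle F s d.-1) _ (KVle_deriv d i)
    (KVle_deriv_is_linear d i).

Definition scale_coord i (c : F) (P : {ffun 'I_s -> F}) : {ffun 'I_s -> F} :=
  [ffun j => if j == i then c * P j else P j].

(** Each exponent of [t_i] is 0 or 1, so [f] is affine in [t_i] and its first-order expansion is
    exact. *)
Lemma meval_scale_coord d i c P (f : {mpoly F[s]}) : is_KVle d f ->
  f.@[scale_coord i c P] = f.@[P] + (c - 1) * (P i * (f^`M(i)).@[P]).
Proof.
move=> /allP fKV; rewrite {1 2}(mpolyE f) /mderiv !raddf_sum /=.
rewrite !mulr_sumr -big_split /= big_seq [RHS]big_seq; apply: eq_bigr => m mf.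
rewrite !mevalZ !mevalX.
rewrite (bigD1 i) //= [X in _ + X](_ : _ = f@_m * ((c - 1) *
  ((m i)%:R * (P i * \prod_j P j ^+ (m - U_(i))%MM j)))); last by ring.
rewrite (bigD1 i (F := fun j => P j ^+ m j)) //=.
rewrite (bigD1 i (F := fun j => P j ^+ (m - U_(i))%MM j)) //=.
rewrite !ffunE eqxx.
under eq_bigr => j /negPf ne do rewrite ffunE ne.
under [X in _ + f@_m * (_ * (_ * (_ * (_ * X))))]eq_bigr => j ne
  do rewrite mnmBE mnm1E eq_sym (negPf ne) subn0.
have /andP[/forallP /(_ i) mi1 _] := fKV m mf.
rewrite mnmBE mnm1E eqxx.
by case: (m i) mi1 => [|[|//]] _; rewrite ?subnn ?expr0 ?expr1 /=; ring.
Qed.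

End SquareFree.

(** * Torus points where a space of polynomials does not vanish *)

Section Hits.
Local Open Scope ring_scope.
Context {F : finFieldType} {s : nat}.
Implicit Types (d : nat) (i : 'I_s) (P : {ffun 'I_s -> F}).

Definition hits {d} (H : seq (KVle F s d)) : {set {ffun 'I_s -> F}} :=
  torus F s :\: torus_zeros [seq KVle_val f | f <- H].

Lemma in_hits d (H : seq (KVle F s d)) P :
  (P \in hits H) = (P \in torus F s) && has (fun f => (KVle_val f).@[P] != 0) H.
Proof.
rewrite in_setD [P \in torus_zeros _]inE negb_and all_map -has_predC.
by case: (P \in torus F s); rewrite /= ?andbT ?andbF.
Qed.

(** Common zeros of a family are common zeros of its span, so only the span matters. *)
Lemma hitsP d (H : seq (KVle F s d)) P :
  reflect (P \in torus F s /\ exists2 f, f \in <<H>>%VS & (KVle_val f).@[P] != 0)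
          (P \in hits H).
Proof.
rewrite in_hits; case TP: (P \in torus F s); last by right; case.
apply: (iffP hasP) => [[f fH fP]|[_ [f fH fP]]].
  by split=> //; exists f => //; apply: memv_span.
apply/hasP; apply: contraNT fP => /hasPn H0; apply/eqP.
rewrite (coord_span (X := in_tuple H) fH) KVle_val_sum raddf_sum big1 // => j _.
rewrite KVle_valZ /= mevalZ.
have /H0 : H`_j \in H by rewrite mem_nth.
by rewrite /= negbK => /eqP ->; rewrite mulr0.
Qed.

Definition vhits {d} (V : {vspace KVle F s d}) := hits (vbasis V).

Lemma vhitsP d (V : {vspace KVle F s d}) P :
  reflect (P \in torus F s /\ exists2 f, f \in V & (KVle_val f).@[P] != 0)
          (P \in vhits V).
Proof. by rewrite -{1}(span_basis (vbasisP V)); apply: hitsP. Qed.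

Lemma vhits_span d (H : seq (KVle F s d)) : vhits <<H>>%VS = hits H.
Proof. by apply/setP => P; apply/vhitsP/hitsP. Qed.

Lemma in_torus P : (P \in torus F s) = [forall i, P i != 0].
Proof. by rewrite inE. Qed.

Lemma scale_coord_inj i (c : F) : c != 0 -> injective (scale_coord i c).
Proof.
move=> c0 P Q /ffunP eqPQ; apply/ffunP => j.
by have := eqPQ j; rewrite !ffunE; case: eqP => // _ /(mulfI c0).
Qed.

Lemma scale_coord_torus i (c : F) P :
  c != 0 -> P \in torus F s -> scale_coord i c P \in torus F s.
Proof.
move=> c0; rewrite !in_torus => /forallP P0; apply/forallP => j.
by rewrite ffunE; case: (j == i); rewrite ?mulf_neq0.
Qed.

Let q := #|F|.

Lemma card_nonzero : #|[pred c : F | c != 0]| = (q - 1)%N.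
Proof. by rewrite subn1 -(cardC1 (0 : F)); apply: eq_card. Qed.

Definition dvar {d} i : 'Hom(KVle F s d, KVle F s d.-1) :=
  linfun (KVle_deriv d i).

Lemma dvarE d i (f : KVle F s d) : KVle_val (dvar i f) = (KVle_val f)^`M(i).
Proof. by rewrite lfunE. Qed.

(* Along the orbit of [P] under scaling of the [i]-th coordinate, [f] is affine
   with slope [P i * f^`M(i).@[P]], hence has at most one zero unless the slope
   vanishes. *)
Lemma card_scaled_hits d i (V : {vspace KVle F s d}) P :
  ((q - 2) * (P \in vhits (dvar i @: V)) + (P \in vhits (V :&: lker (dvar i)))
   <= #|[pred c : F | (c != 0)%R && (scale_coord i c P \in vhits V)]|)%N.
Proof.
have affE c (f : KVle F s d) : (KVle_val f).@[scale_coord i c P]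
    = (KVle_val f).@[P] + (c - 1) * (P i * (KVle_val (dvar i f)).@[P]).
  by rewrite dvarE; apply: meval_scale_coord (valP f).
have [/vhitsP [TP [f]]|nV0] := boolP (P \in vhits (V :&: lker _)).
  rewrite memv_cap memv_ker => /andP [fV /eqP df0] fP.
  (* [f] is constant along the orbit, so all [q - 1] scalings count; this also covers the case where
     both indicators are 1. *)
  apply: (@leq_trans (q - 1)).
    have := finNzRing_gt1 F; rewrite -/q; case: (_ \in _); lia.
  rewrite -card_nonzero subset_leq_card //; apply/subsetP => c; rewrite inE => c0.
  rewrite inE c0; apply/vhitsP; split; first exact: scale_coord_torus.
  by exists f => //; rewrite affE df0 meval0 !mulr0 addr0.
rewrite addn0.
have [|_] := boolP (P \in vhits (_ @: _)); last by rewrite muln0.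
case/vhitsP=> TP [_ /memv_imgP [f fV ->] dfP].
have P0 : P i != 0 by move: TP; rewrite in_torus => /forallP.
pose b := P i * (KVle_val (dvar i f)).@[P].
have b0 : b != 0 by apply: mulf_neq0.
(* The only scaling at which [f] can vanish. It may be 0, whence an inequality rather than an
   equality. *)
pose z := 1 - (KVle_val f).@[P] / b.
rewrite muln1; apply: (@leq_trans #|[predD1 [pred c : F | c != 0] & z]|).
  rewrite -[2%N]/(1 + 1)%N subnDA leq_subLR -card_nonzero (cardD1 z).
  by rewrite leq_add2r leq_b1.
rewrite subset_leq_card //; apply/subsetP => c; rewrite inE => /andP [cz c0].
rewrite inE (c0 : c != 0); apply/vhitsP; split; first exact: scale_coord_torus.
exists f => //; rewrite affE -/b; apply: contraNneq cz => fc0.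
apply/eqP; rewrite /z; apply: (mulIf b0).
rewrite mulrBl divfK // mul1r; apply/eqP; rewrite -subr_eq0 -[X in _ == X]fc0.
by apply/eqP; ring.
Qed.

(** Double counting of the pairs [(c, P)] with [c != 0] and [scale_coord i c P] in [vhits V]: each
    such [c] permutes the points, and [card_scaled_hits] bounds the count at each [P]. *)
Lemma card_vhits_rec d i (V : {vspace KVle F s d}) :
  ((q - 2) * #|vhits (dvar i @: V)| + #|vhits (V :&: lker (dvar i))|
   <= (q - 1) * #|vhits V|)%N.
Proof.
have card_sum (A : {set {ffun 'I_s -> F}}) : #|A| = (\sum_P (P \in A))%N.
  by rewrite -sum1_card big_mkcond; apply: eq_bigr => P _; case: (P \in A).
rewrite -card_nonzero -sum_nat_const.
rewrite (eq_bigr (fun c => \sum_P (scale_coord i c P \in vhits V))%N); last first.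
  move=> c c0; rewrite -(card_preimset _ (scale_coord_inj i c c0)) card_sum.
  by apply: eq_bigr => P _; rewrite inE.
rewrite exchange_big /= !card_sum big_distrr -big_split /=; apply: leq_sum => P _.
apply: leq_trans (card_scaled_hits d i V P) _.
by rewrite -sum1_card big_mkcondr; apply: leq_sum => c _; case: (_ \in _).
Qed.

End Hits.

(** * Lower bound by induction on the variables *)

Section LowerBound.
Local Open Scope ring_scope.
Context {F : finFieldType} {s : nat}.
Implicit Types (d : nat) (i : 'I_s).

(** Square-freeness makes this true in every characteristic: an exponent 1 survives differentiation
    with coefficient 1. *)
Lemma KVle_const d (f : KVle F s d) :
  (forall i, (KVle_val f)^`M(i) = 0) -> KVle_val f = ((KVle_val f)@_0)%:MP.
Proof.
move=> df0; apply/mpolyP => m; rewrite mcoeffC eq_sym.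
have [<-|m0] := eqVneq 0%MM m; rewrite ?mulr1 // mulr0.
have /existsP [i mi] : [exists i, m i != 0%N].
  apply: contraNT m0 => /existsPn mi; apply/eqP/mnmP => i.
  by rewrite mnm0E; have /negPn/eqP := mi i.
apply/eqP/negPn/negP => fm0; have := fm0; rewrite -mcoeff_msupp => mf.
have /andP [/forallP /(_ i) mi1 _] := allP (valP f) m mf.
have {mi1}mi1 : m i = 1%N by lia.
have leUm : (U_(i) <= m)%MM.
  by apply/mnm_lepP => j; rewrite mnm1E; case: eqP => // <-; rewrite mi1.
have := mcoeff_deriv i (m - U_(i))%MM (KVle_val f).
rewrite df0 mcoeff0 submK // mnmBE mnm1E eqxx mi1 mulr1n => /esym f0.
by rewrite f0 eqxx in fm0.
Qed.

Let y : rat := (#|F| - 1)%:R^-1.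
Let p : rat := 1 - y.

Let Q_gt0 : 0 < (#|F| - 1)%:R :> rat.
Proof. by rewrite ltr0n subn_gt0 finNzRing_gt1. Qed.

Let y_gt0 : 0 < y. Proof. by rewrite invr_gt0. Qed.

Let y_le1 : y <= 1.
Proof.
by rewrite invf_le1 // ler1n subn_gt0 finNzRing_gt1.
Qed.

Let p_ge0 : 0 <= p. Proof. by rewrite subr_ge0. Qed.

(** Base case: [V] lies in the line of constants. If it is nonzero, every torus point is hit and the
    claim is [p ^+ d * p <= p], up to the factor [#|torus F s|]. *)
Lemma vhits_lower_const d (V : {vspace KVle F s d}) :
  (forall i f, f \in V -> (KVle_val f)^`M(i) = 0) ->
  p ^+ d * (1 - y ^+ \dim V) * #|torus F s|%:R <= p * #|vhits V|%:R.
Proof.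
move=> dV0.
have KV1 : is_KVle d (1 : {mpoly F[s]}).
  apply/allP => m; rewrite msupp1 inE => /eqP ->; rewrite mdeg0 andbT.
  by apply/forallP => i; rewrite mnm0E.
have VC f : f \in V -> KVle_val f = ((KVle_val f)@_0)%:MP.
  by move=> fV; apply: KVle_const => i; apply: dV0.
have : (\dim V <= \dim <[MkKVle KV1]>)%N.
  apply/dimvS/subvP => f fV; apply/vlineP; exists ((KVle_val f)@_0).
  apply: val_inj; rewrite [LHS](VC f fV) [RHS]KVle_valZ /=.
  by rewrite -mul_mpolyC mulr1.
rewrite dim_vline => leV1.
have [V0|V0] := eqVneq V 0%VS.
  by rewrite V0 dimv0 expr0 subrr mulr0 mul0r mulr_ge0.
have dV1 : \dim V = 1%N.
  by apply/eqP; rewrite eqn_leq lt0n dimv_eq0 V0 andbT (leq_trans leV1) ?leq_b1.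
have -> : vhits V = torus F s.
  apply/setP => P; apply/vhitsP/idP => [[]//|TP]; split=> //.
  exists (vpick V); first exact: memv_pick.
  rewrite (VC _ (memv_pick V)) mevalC.
  apply: contraNneq V0 => f0; rewrite -vpick0; apply/eqP/val_inj.
  by rewrite [LHS](VC _ (memv_pick V)) f0.
rewrite dV1 expr1 -/p ler_wpM2r // mulrC ler_piMr // exprn_ile1 //.
by rewrite gerBl ltW.
Qed.

Lemma vhits_lower d (V : {vspace KVle F s d}) :
  p ^+ d * (1 - y ^+ \dim V) * #|torus F s|%:R <= p * #|vhits V|%:R.
Proof.
(* [J] contains every variable occurring in [V]; [d] and [V] vary since differentiation changes
   both. *)
suff {d V} vhits_lowerJ n : forall d (V : {vspace KVle F s d}) (J : {set 'I_s}),
    (#|J| <= n)%N ->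
    (forall i f, i \notin J -> f \in V -> (KVle_val f)^`M(i) = 0) ->
    p ^+ d * (1 - y ^+ \dim V) * #|torus F s|%:R <= p * #|vhits V|%:R.
  by apply: (vhits_lowerJ #|[set: 'I_s]| d V setT) => // i f; rewrite inE.
elim: n => [|n IHn] d V J.
  rewrite leqn0 cards_eq0 => /eqP -> dV0; apply: vhits_lower_const => i f.
  by apply: dV0; rewrite inE.
move=> leJ dV0; case: d V dV0 => [|d] V dV0.
  apply: vhits_lower_const => i f _; apply/mpolyP => m.
  rewrite mcoeff_deriv mcoeff0.
  have [/(allP (valP f))|/memN_msupp_eq0 ->] :=
      boolP ((m + U_(i))%MM \in msupp (KVle_val f)).
    by rewrite mdegD mdeg1 addn1 ltn0 andbF.
  by rewrite mul0rn.
have [J0|[i iJ]] := set_0Vmem J.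
  by apply: vhits_lower_const => i f; apply: dV0; rewrite J0 inE.
have leJ' : (#|J :\ i| <= n)%N by move: leJ; rewrite (cardsD1 i) iJ.
(* If [dvar i] kills [V], then [i] leaves [J]. Otherwise the image has dimension at least 1, as the
   final inequality needs. *)
have [dimV0 | W0] := eqVneq (dvar i @: V)%VS 0%VS.
  apply: (IHn _ _ (J :\ i)) => // j f; rewrite in_setD1 negb_and negbK.
  case/orP=> [/eqP -> fV|jJ]; last exact: dV0.
  have : dvar i f \in (dvar i @: V)%VS by apply: memv_img.
  by rewrite dimV0 memv0 -dvarE => /eqP ->.
have IH1 : p ^+ d * (1 - y ^+ \dim (dvar i @: V)) * #|torus F s|%:R
    <= p * #|vhits (dvar i @: V)|%:R.
  apply: (IHn _ _ (J :\ i)) => // j _ jJ /memv_imgP [f fV ->].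
  rewrite dvarE mderiv_comm.
  move: jJ; rewrite in_setD1 negb_and negbK => /orP [/eqP ->|jJ]; last first.
    by rewrite (dV0 j) // mderiv0.
  (* second derivatives of square-free polynomials vanish *)
  apply/mpolyP => m; rewrite !mcoeff_deriv mcoeff0.
  have [/(allP (valP f))|/memN_msupp_eq0 ->] :=
      boolP ((m + U_(i) + U_(i))%MM \in msupp (KVle_val f)); last by rewrite !mul0rn.
  case/andP=> /forallP /(_ i) + _.
  by rewrite !mnmDE mnm1E eqxx; lia.
have IH0 : p ^+ d.+1 * (1 - y ^+ \dim (V :&: lker (dvar i))) * #|torus F s|%:R
    <= p * #|vhits (V :&: lker (dvar i))|%:R.
  apply: (IHn _ _ (J :\ i)) => // j f; rewrite in_setD1 negb_and negbK memv_cap.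
  case/orP=> [/eqP ->|jJ] /andP [fV]; last by move=> _; apply: dV0.
  by rewrite memv_ker -dvarE => /eqP ->.
have dimV := limg_ker_dim (dvar i) V.
move: IH1 IH0 W0 (card_vhits_rec d.+1 i V); rewrite -dimV -dimv_eq0.
move: (\dim (dvar i @: V)) (\dim (V :&: _)) => a b IH1 IH0 a0.
rewrite -(ler_nat rat) natrD !natrM => rec.
have {}rec : p * #|vhits (dvar i @: V)|%:R
    + y * #|vhits (V :&: lker (dvar i))|%:R <= #|vhits V|%:R.
  rewrite -(ler_pM2l Q_gt0); apply: le_trans rec.
  rewrite le_eqVlt; apply/orP; left; apply/eqP.
  rewrite mulrDr !mulrA divff ?gt_eqF // mul1r; congr (_ * _ + _).
  rewrite mulrBr mulr1 divff ?gt_eqF // -(@natrB _ _ 1) ?subn_gt0 ?finNzRing_gt1 //.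
  by rewrite -subnDA.
have ya_le : y ^+ a <= y by rewrite -[leRHS]expr1 ler_wiXn2l ?lt0n // ltW.
have yb_le1 : y ^+ b <= 1 by rewrite exprn_ile1 // ltW.
apply: le_trans (ler_wpM2l p_ge0 rec); rewrite [leRHS]mulrDr [p * (y * _)]mulrCA.
apply: le_trans (lerD (ler_wpM2l p_ge0 IH1) (ler_wpM2l (ltW y_gt0) IH0)).
have pdT : 0 <= p ^+ d.+1 * #|torus F s|%:R by rewrite mulr_ge0 ?exprn_ge0.
(* Times [p ^+ d.+1 * #|torus F s|], this product is the exact gap between the combined inductive
   bounds and the goal. *)
have key : 0 <= (y - y ^+ a) * (1 - y ^+ b) by rewrite mulr_ge0 ?subr_ge0.
rewrite -subr_ge0 exprD; move: (mulr_ge0 pdT key); rewrite exprS.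
by congr (0 <= _); ring.
Qed.

End LowerBound.

(** * Upper bound from a sunflower of variable sets *)

Section UpperBound.
Local Open Scope ring_scope.
Context {F : finFieldType} {s : nat}.
Let q := #|F|.

(** Expansion takes ['X_j] or a constant from each factor; a duplicate-free [l] therefore gives
    square-free monomials. *)
Lemma mpoly_prod_X_sub1_supp (l : seq 'I_s) (m : 'X_{1..s}) k :
  m \in msupp (\prod_(j <- l) ('X_j - 1) : {mpoly F[s]}) ->
  (m k <= count_mem k l)%N.
Proof.
elim: l m => [|j l IHl] m.
  by rewrite big_nil msupp1 inE => /eqP ->; rewrite mnm0E.
rewrite big_cons => /msuppM_le /allpairsP [[m1 m2] /= [m1j m2l ->]].
rewrite mnmDE leq_add ?IHl // {IHl m2l}.
have /msuppD_le := m1j.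
rewrite mem_cat msuppX inE (perm_mem (msuppN _)) msupp1 inE.
by case/orP => /eqP ->; rewrite ?mnm0E // mnm1E.
Qed.

Lemma prod_X_sub1_is_KVle d (A : {set 'I_s}) : (#|A| <= d)%N ->
  is_KVle d (\prod_(j in A) ('X_j - 1) : {mpoly F[s]}).
Proof.
move=> leAd; rewrite -big_enum; apply/allP => m msm.
have leA k : (m k <= (k \in A))%N.
  apply: leq_trans (mpoly_prod_X_sub1_supp _ _ k msm) _.
  by rewrite count_uniq_mem ?enum_uniq // mem_enum.
apply/andP; split.
  by apply/forallP => k; apply: leq_trans (leA k) (leq_b1 _).
apply: leq_trans leAd; rewrite mdegE -sum1_card [leqRHS]big_mkcond.
by apply: leq_sum => k _; apply: leq_trans (leA k) _; case: (k \in A).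
Qed.

Lemma meval_prod_X_sub1 (A : {set 'I_s}) (P : 'I_s -> F) :
  (\prod_(j in A) ('X_j - 1) : {mpoly F[s]}).@[P] = \prod_(j in A) (P j - 1).
Proof.
by rewrite rmorph_prod; apply: eq_bigr => j _; rewrite /= mevalB mevalXU meval1.
Qed.

Lemma card_not01 : #|[pred c : F | (c != 0) && (c != 1)]| = (q - 2)%N.
Proof.
have := cardD1 1 [pred c : F | c != 0].
rewrite card_nonzero inE oner_neq0 /= -[2%N]/(1 + 1)%N subnDA => ->.
by rewrite addKn; apply: eq_card => c; rewrite !inE andbC.
Qed.

(** The points hit by the extremal family lie in [box d 0] but outside [box d r]: the common factors
    are nonzero, and the [r] further coordinates are not all 1. *)
Definition box a b : {pred {ffun 'I_s -> F}} :=
  family (fun j : 'I_s => [pred c : F | [&& c != 0, (j < a)%N ==> (c != 1) &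
                                   (a <= j < a + b)%N ==> (c == 1)]]).

Lemma card_box a b : (a + b <= s)%N ->
  #|box a b| = ((q - 2) ^ a * (q - 1) ^ (s - (a + b)))%N.
Proof.
move=> le_ab; rewrite card_family foldrE big_image.
pose g j := (if (j < a) then q - 2 else if j < a + b then 1 else q - 1)%N.
rewrite (eq_bigr (fun j : 'I_s => g j)) => [|j _]; last first.
  rewrite /g; case: (ltnP j a) => _.
    by rewrite -card_not01; apply: eq_card => c; rewrite !inE /= andbT.
  case: (ltnP j (a + b)) => _; last first.
    by rewrite -[RHS]/(#|F| - 1)%N -card_nonzero; apply: eq_card => c; rewrite !inE /= ?andbT.
  rewrite -[RHS]/1%N -(card1 (1 : F)); apply: eq_card => c; rewrite !inE /=.
  by case: (eqVneq c 1) => [->|]; rewrite ?oner_neq0 ?andbF.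
rewrite -(big_mkord xpredT g) (big_cat_nat (leq0n a) (leq_trans (leq_addr b a) le_ab)) /=.
rewrite (big_cat_nat (leq_addr b a) le_ab) /=.
rewrite (eq_big_nat _ _ (F2 := fun=> (q - 2)%N)) => [|j]; last first.
  by rewrite /g => /andP [_ ->].
rewrite (eq_big_nat _ _ (m := a) (F2 := fun=> 1%N)) => [|j]; last first.
  by rewrite /g => /andP [le_aj ->]; rewrite ltnNge le_aj.
rewrite (eq_big_nat _ _ (m := (a + b)%N) (F2 := fun=> (q - 1)%N)) => [|j].
  by rewrite !prod_nat_const_nat exp1n mul1n subn0.
by rewrite /g => /andP [le_aj _]; do 2 (case: ltnP; first by lia).
Qed.

Section Star.
Variables (d r : nat).
Hypothesis le_dr : (d + r <= s)%N.

Lemma petal_subproof (i : 'I_r) : (d + i < s)%N.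
Proof. by apply: leq_trans le_dr; rewrite ltn_add2l. Qed.

Definition petal (i : 'I_r) : 'I_s := Ordinal (petal_subproof i).
(** A sunflower: the first [d] variables form the common core. Here [d] is one less than the degree
    bound, and indices start at 0. *)
Definition star (i : 'I_r) : {set 'I_s} := petal i |: [set j : 'I_s | j < d]%N.

Lemma card_star i : (#|star i| <= d.+1)%N.
Proof.
rewrite cardsU1 -add1n leq_add ?leq_b1 // -sum1dep_card.
by rewrite -(big_ord_widen _ (fun=> 1%N)) ?sum1_card ?card_ord //; lia.
Qed.

Lemma petal_star i k : (petal k \in star i) = (k == i).
Proof.
rewrite in_setU1 inE /= [(_ < d)%N]ltnNge leq_addr orbF.
by rewrite -val_eqE /= eqn_add2l.
Qed.

Definition star_poly (i : 'I_r) : KVle F s d.+1 :=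
  MkKVle (prod_X_sub1_is_KVle d.+1 (star i) (card_star i)).

(* The polynomials are separated by points outside the torus: on the torus they
   would all vanish when [#|F| = 2]. *)
Lemma star_poly_free : free (mktuple star_poly).
Proof.
apply/freeP => a lin0 i.
have {}lin0 : \sum_k a k *: star_poly k = 0.
  by rewrite -[RHS]lin0; apply: eq_bigr => k _; rewrite -tnth_nth tnth_mktuple.
(* At this point [star_poly i] is a product of factors -1, while every other [star_poly k] has the
   factor 0 at [petal k]. *)
pose P j : F := (j \notin star i)%:R.
have := congr1 (fun f => (KVle_val f).@[P]) lin0.
rewrite KVle_val_sum raddf_sum meval0 (bigD1 i) // big1 => [|k ki].
  rewrite KVle_valZ /= addr0 mevalZ meval_prod_X_sub1.
  move/eqP; rewrite mulf_eq0 => /orP [/eqP //|].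
  case/prodf_eq0 => j jA; rewrite /P jA sub0r oppr_eq0 oner_eq0 //.
rewrite KVle_valZ /= mevalZ meval_prod_X_sub1.
rewrite (bigD1 (petal k)) ?petal_star //= /P petal_star (negPf ki) subrr.
by rewrite mul0r mulr0.
Qed.

Lemma card_star_hits :
  (#|hits (mktuple star_poly)|
   <= (q - 2) ^ d * (q - 1) ^ (s - (d + r)) * ((q - 1) ^ r - 1))%N.
Proof.
have -> : ((q - 2) ^ d * (q - 1) ^ (s - (d + r)) * ((q - 1) ^ r - 1)
           = #|box d 0| - #|box d r|)%N.
  rewrite !card_box ?addn0 ?(leq_trans (leq_addr r d)) // mulnBr muln1 -mulnA.
  by rewrite -expnD; congr (_ * _ ^ _ - _)%N; lia.
have sub_box : {subset box d r <= box d 0}.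
  move=> P /familyP Pbox; apply/familyP => j; have := Pbox j.
  by rewrite !inE addn0 => /and3P [-> -> _]; case: (ltnP j d).
rewrite -(cardID (box d r) (box d 0)).
rewrite (_ : #|[predI box d 0 & box d r]| = #|box d r|); last first.
  by apply: eq_card => P; rewrite inE; apply/andb_idl/sub_box.
rewrite addKn; apply/subset_leq_card/subsetP => P.
rewrite in_hits in_torus => /andP [/forallP P0 /hasP [f /mapP [i _ ->]]].
rewrite meval_prod_X_sub1 => /prodf_neq0 P1.
have {}P1 j : j \in star i -> P j != 1 by move/P1; rewrite subr_eq0.
rewrite inE; apply/andP; split.
  apply/negP => /familyP /(_ (petal i)).
  by rewrite !inE /= leq_addr ltn_add2l ltn_ord (negPf (P1 _ _)) ?petal_star ?andbF.
apply/familyP => j; rewrite !inE P0 addn0 /=.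
by case: ltnP => //= jd; rewrite andbT P1 // !inE jd orbT.
Qed.

End Star.
End UpperBound.

(** * Natural-number form of the lower bound, and the weight *)

Section Weight.
Context {F : finFieldType} {s : nat}.
Let q := #|F|.

Lemma card_torus : #|torus F s| = (q - 1) ^ s.
Proof.
rewrite -[X in _ ^ X]card_ord -(@card_nonzero F) -card_ffun_on; apply: eq_card => P.
rewrite in_torus; apply/forallP/ffun_onP => P0 j; exact: P0.
Qed.

Lemma card_vhits_ge d (V : {vspace KVle F s d.+1}) : d + \dim V <= s ->
  (q - 2) ^ d * (q - 1) ^ (s - (d + \dim V)) * ((q - 1) ^ \dim V - 1)
    <= #|vhits V|.
Proof.
move=> le_s; have q1 : 1 < q := finNzRing_gt1 F.
(* The case [q = 2] is separate because [p = 0] cannot be cancelled; the bound is then 0. *)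
case: (ltngtP q 2) => [|q3|->]; [by lia| |by rewrite !exp1n subnn muln0].
have Q0 : (0 < (q - 1)%:R :> rat)%R by rewrite ltr0n; lia.
have := vhits_lower _ V; rewrite -/q card_torus; move: (\dim V) le_s => r le_s.
set p := (1 - _)%R.
have pE : (p * (q - 1)%:R = (q - 2)%:R :> rat)%R.
  rewrite mulrBl mul1r mulVf ?gt_eqF // -(@natrB _ _ 1); last by lia.
  by rewrite -subnDA.
have p0 : (0 < p)%R.
  by rewrite -(pmulr_lgt0 _ Q0) pE ltr0n; lia.
rewrite exprS -!mulrA ler_pM2l // -(ler_nat rat); apply: le_trans.
rewrite le_eqVlt; apply/orP; left; apply/eqP.
move: (subnKC le_s); move: (s - (d + r)) => e <-.
rewrite !natrM natrB ?expn_gt0 ?subn_gt0 ?q1 // !natrX -pE !exprD exprMn exprVn.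
by field; rewrite expf_neq0 // gt_eqF.
Qed.

End Weight.

(* The exponent [s - d - r + 1] is written [(s + 1) - (d + r)], since the
   truncated difference [s - d - r] would be wrong when [d + r = s + 1]. *)
Theorem theorem4p10 (F : finFieldType) (s d r : nat)
    (hs : 2 <= s) (hd1 : 1 <= d) (hds : d <= s)
    (hr1 : 1 <= r) (hr : r <= \dim (fullv : {vspace KVle F s d}))
    (hdr : d + r - 2 < s) :
  ghw F s d r =
    (#|F| - 2) ^ (d - 1) * (#|F| - 1) ^ ((s + 1) - (d + r))
      * ((#|F| - 1) ^ r - 1).
Proof.
(* From here on [d] is the degree minus one. *)
case: d hd1 hds hr hdr => // d _ _ hr hdr.
have le_s : d + r <= s by lia.
rewrite subn1 /= addn1 addSn subSS.
have [[H freeH ghwE] le_ghw] := ghwP hr.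
have dimH : \dim <<H>> = r by rewrite (eqP freeH) size_tuple.
apply/eqP; rewrite eqn_leq; apply/andP; split.
  exact: leq_trans (le_ghw _ (star_poly_free d r le_s)) (card_star_hits d r le_s).
by have := card_vhits_ge d <<H>>; rewrite dimH vhits_span ghwE; apply.
Qed.
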